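(* Let $F$ be a field of characteristic $0$, let $X=\{x_i\mid i\in I\}$ with $I$ a well-ordered set, and let $\mathrm{Nov}\langle X\rangle$ be the free Novikov algebra over $F$ generated by $X$. Let $N(X)$ be the set of normal forms of the differential monomials of weight $-1$ in $X$, and let $\varphi\colon N(X)\to \mathrm{Magma}\langle X\rangle$ be the map to nonassociative words in $X$ (both defined in the context). Then the set $N_\varphi=\{\varphi(a)\mid a\in N(X)\}$, whose elements are evaluated in $\mathrm{Nov}\langle X\rangle$ as nonassociative words with respect to $\circ$, forms a linear basis of $\mathrm{Nov}\langle X\rangle$ (the images of the $\varphi(a)$ for distinct $a\in N(X)$ being distinct).
   Context: All algebras are over a field $F$ of characteristic $0$. Novikov algebra: a vector space with a bilinear product $\circ$ satisfying $(x_1\circ x_2)\circ x_3-x_1\circ(x_2\circ x_3)=(x_2\circ x_1)\circ x_3-x_2\circ(x_1\circ x_3)$ and $(x_1\circ x_2)\circ x_3=(x_1\circ x_3)\circ x_2$. $\mathrm{Magma}\langle X\rangle$ is the free (nonassociative) algebra generated by $X$ with one bilinear operation $\circ$. Differential monomials: $\mathrm{ComDer}\langle X\rangle$ is the free commutative (associative) algebra generated by $X$ with a derivation $d$; it is the polynomial algebra in the letters $x^{(r)}$, $x\in X$, $r\ge 0$, where $x^{(0)}=x$, $x^{(r+1)}=d(x^{(r)})$, $x'=x^{(1)}$. The weight of a monomial is given by $\mathrm{wt}(x^{(r)})=r-1$ and $\mathrm{wt}(uv)=\mathrm{wt}(u)+\mathrm{wt}(v)$. Order the letters by: $x_i^{(r)}>x_j^{(s)}$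 if $r>s$, or $r=s$ and $i>j$. Normal form: every monomial of weight $-1$ is written uniquely as $$x_{i_1}x_{i_2}\cdots x_{i_l}\,x_{j_n}^{(r_n)}\cdots x_{j_1}^{(r_1)}\,x_{k_m}'\cdots x_{k_1}',$$ where $n,m\ge 0$, $r_1,\dots,r_n\ge 2$, $l=r_1+\dots+r_n-n+1$, $x_{i_1}\le\dots\le x_{i_l}$, $x_{j_n}^{(r_n)}\ge\dots\ge x_{j_1}^{(r_1)}$, $x_{k_m}\ge\dots\ge x_{k_1}$. $N(X)$ is the set of all these normal forms. Equivalently, an element of $N(X)$ is $c_1\cdots c_l\,y_N^{(s_N)}\cdots y_1^{(s_1)}$ with $N\ge 0$, $c_1\le\dots\le c_l$ in $X$, $y_i\in X$, $s_i\ge 1$, $y_N^{(s_N)}\ge\dots\ge y_1^{(s_1)}$, $l=1+\sum_{i}(s_i-1)$. The map $\varphi$: it is defined recursively on expressions $c_1\cdots c_l\,y_N^{(s_N)}\cdots y_1^{(s_1)}$ as in the last description, where now the ordered list $c_1,\dots,c_l$ may also contain nonassociative words in $X$, treated as new letters of weight $-1$. If $N=0$ (so $l=1$), then $\varphi(c_1)=c_1$. If $N\ge 1$, put $$B=c_l\circ(c_{l-1}\circ(\cdots\circ(c_{l+1-s_N}\circ y_N)\cdots))$$ (using the last $s_N$ letters of the list $c_1,\dots,c_l$), and set $$\varphi\big(c_1\cdots c_l\,y_N^{(s_N)}\cdots y_1^{(s_1)}\big)=\varphi\big(c_1\cdots c_{l-s_N}\,B\,y_{N-1}^{(s_{N-1})}\cdots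 y_1^{(s_1)}\big),$$ where $B$ is a new letter, greater than all previous letters, hence placed last in the list. For example, if $x,y,z,t,q\in X$, $y>x$, $t>q$, then $\varphi(xyz^{(2)}t'q')=((y\circ(x\circ z))\circ t)\circ q$. *)

(* Defs.v *)
From HB Require Import structures.
From mathcomp Require Import all_boot all_order all_algebra.
From mathcomp Require Import boolp classical_sets.
From mathcomp Require Import zify.
From mathcomp Require Import finmap monalg.

Set Implicit Arguments.
Unset Strict Implicit.
Unset Printing Implicit Defensive.

Import Order.TTheory GRing.Theory Num.Theory.

Local Open Scope ring_scope.

Section Basis.

Variables (F : fieldType) (V : lmodType F).

Definition lin_indep (S : set V) : Prop :=
  forall (s : seq V) (k : V -> F), uniq s -> (forall v, v \in s -> S v) ->
    \sum_(v <- s) k v *: v = 0 -> forall v, v \in s -> k v = 0.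

Definition spanning (S : set V) : Prop :=
  forall u : V, exists (s : seq V) (k : V -> F),
    (forall v, v \in s -> S v) /\ u = \sum_(v <- s) k v *: v.

Definition linear_basis (S : set V) : Prop := lin_indep S /\ spanning S.

End Basis.

(* Nonassociative words in X; they index the canonical basis of the free
   nonassociative algebra {malg F[word X]}. *)
Inductive word (X : Type) : Type :=
| Letter of X
| Op of word X & word X.

Arguments Letter {X} _.
Arguments Op {X} _ _.

Section WordChoice.

Variable X : Type.

Fixpoint word_encode (w : word X) : GenTree.tree X :=
  match w with
  | Letter x => GenTree.Leaf x
  | Op u v => GenTree.Node 0 [:: word_encode u; word_encode v]
  end.

Fixpoint word_decode (t : GenTree.tree X) : option (word X) :=
  match t with
  | GenTree.Leaf x => Some (Letter x)
  | GenTree.Node _ [:: t1; t2] =>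
      if (word_decode t1, word_decode t2) is (Some u, Some v)
      then Some (Op u v) else None
  | _ => None
  end.

Lemma word_encodeK : pcancel word_encode word_decode.
Proof. by elim=> [x|u IHu v IHv] //=; rewrite IHu IHv. Qed.

End WordChoice.

HB.instance Definition _ (X : eqType) :=
  Equality.copy (word X) (pcan_type (@word_encodeK X)).
HB.instance Definition _ (X : choiceType) :=
  Choice.copy (word X) (pcan_type (@word_encodeK X)).

Fixpoint word_eval (X A : Type) (m : A -> A -> A) (i : X -> A) (w : word X) : A :=
  match w with
  | Letter x => i x
  | Op u v => m (word_eval m i u) (word_eval m i v)
  end.

(* nov_linl and nov_linr say that the product m is bilinear. *)
Record novikov (F : fieldType) (A : lmodType F) (m : A -> A -> A) : Prop := {
  nov_linl : forall v, linear (m^~ v);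
  nov_linr : forall u, linear (m u);
  nov_lsym : forall x1 x2 x3,
    m (m x1 x2) x3 - m x1 (m x2 x3) = m (m x2 x1) x3 - m x2 (m x1 x3);
  nov_rcomm : forall x1 x2 x3, m (m x1 x2) x3 = m (m x1 x3) x2
}.

(* The linear map from the free vector space on K that sends << k >> to h k. *)
HB.lock Definition lin_ext (F : fieldType) (K : choiceType) (V : lmodType F)
    (h : K -> V) (g : {malg F[K]}) : V :=
  \sum_(k <- msupp g) g@_k *: h k.

Section LinearExtension.

Variables (F : fieldType) (K : choiceType) (V : lmodType F) (h : K -> V).

Lemma lin_extE (g : {malg F[K]}) : lin_ext h g = \sum_(k <- msupp g) g@_k *: h k.
Proof. by rewrite lin_ext.unlock. Qed.

Lemma lin_extEw (g : {malg F[K]}) (d : {fset K}) :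
  (msupp g `<=` d)%fset -> lin_ext h g = \sum_(k <- d) g@_k *: h k.
Proof.
move=> sgd; rewrite lin_extE; apply/esym.
rewrite (big_fset_incl _ sgd) // => k _ kg.
by rewrite mcoeff_outdom // scale0r.
Qed.

Lemma lin_ext_linear : linear (lin_ext h).
Proof.
move=> a u v.
pose d := (msupp u `|` msupp v `|` msupp (a *: u + v))%fset.
rewrite !(@lin_extEw _ d); try by apply/fsubsetP=> k; rewrite !inE => ->; rewrite ?orbT.
rewrite scaler_sumr -big_split /=; apply: eq_bigr => k _.
by rewrite mcoeffD mcoeffZ scalerDl scalerA.
Qed.

HB.instance Definition _ :=
  GRing.isLinear.Build F {malg F[K]} V *:%R (lin_ext h) lin_ext_linear.

Lemma lin_extU k : lin_ext h << k >> = h k.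
Proof.
rewrite (@lin_extEw _ [fset k]%fset) ?msuppU_le //.
by rewrite big_seq_fset1 mcoeffUU scale1r.
Qed.

Lemma lin_ext_comp (W : lmodType F) (f : V -> W) (g : {malg F[K]}) :
  linear f -> f (lin_ext h g) = lin_ext (f \o h) g.
Proof.
move=> fL; pose mf := GRing.isLinear.Build F V W *:%R f fL.
pose f' : {linear V -> W} := HB.pack f mf.
rewrite !lin_ext.unlock -[f]/(f' : V -> W) linear_sum.
by apply: eq_bigr => k _; rewrite linearZ.
Qed.

End LinearExtension.

Lemma lin_ext_id (F : fieldType) (K : choiceType) (g : {malg F[K]}) :
  lin_ext (fun k => << k >> : {malg F[K]}) g = g.
Proof.
rewrite lin_extE [RHS]monalgE; apply: eq_bigr => k _.
by apply/malgP => l; rewrite mcoeffZ !mcoeffU mulrnAr mulr1.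
Qed.

(* V / S presented by a surjective linear projection with kernel S. *)
Record quotient_space (F : fieldType) (V : lmodType F) (S : V -> Prop) := {
  qs_sort : lmodType F;
  qs_pi : {linear V -> qs_sort};
  qs_repr : qs_sort -> V;
  qs_reprK : cancel qs_repr qs_pi;
  qs_piP : forall u v, qs_pi u = qs_pi v <-> S (u - v)
}.

Record subspace (F : fieldType) (V : lmodType F) (S : V -> Prop) : Prop := {
  subspace0 : S 0;
  subspaceD : forall u v, S u -> S v -> S (u + v);
  subspaceZ : forall (c : F) u, S u -> S (c *: u)
}.

Section QuotientSpace.

Variables (F : fieldType) (V : lmodType F) (S : V -> Prop).
Hypothesis subS : subspace S.

Definition qs_pred of subspace S : V -> bool := fun u => `[< S u >].

Fact qs_zmod_closed : zmod_closed (qs_pred subS : {pred V}).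
Proof.
split=> [|u v /asboolP Su /asboolP Sv]; apply/asboolP; first exact: subspace0.
by rewrite -scaleN1r; apply: subspaceD => //; apply: subspaceZ.
Qed.

HB.instance Definition _ :=
  GRing.isZmodClosed.Build V (qs_pred subS) qs_zmod_closed.

Definition qs_type : Type :=
  Quotient.quot (GRing.ZmodClosed.clone V (qs_pred subS) _).

HB.instance Definition _ := GRing.Zmodule.on qs_type.

Let pi (u : V) : qs_type := (\pi_qs_type u)%qT.
Let rep (u : qs_type) : V := generic_quotient.repr u.

Let repK : cancel rep pi. Proof. exact: generic_quotient.reprK. Qed.

Let piP u v : pi u = pi v <-> S (u - v).
Proof.
split=> [h|/asboolP h].
  by move/eqP: h; rewrite -[_ == _]Quotient.idealrBE => /asboolP.
by apply/eqP; rewrite -[_ == _]Quotient.idealrBE.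
Qed.

Let piB : zmod_morphism pi. Proof. exact: pi_is_zmod_morphism. Qed.

HB.instance Definition _ := GRing.isZmodMorphism.Build V qs_type pi piB.

Definition qs_scale (c : F) (u : qs_type) : qs_type := pi (c *: rep u).

Let piZ c u : pi (c *: u) = qs_scale c (pi u).
Proof. by apply/piP; rewrite -scalerBr; apply/(subspaceZ subS)/piP; rewrite repK. Qed.

Fact qs_scaleA a b v : qs_scale a (qs_scale b v) = qs_scale (a * b) v.
Proof. by rewrite -[v]repK -!piZ scalerA. Qed.

Fact qs_scale1 : left_id 1 qs_scale.
Proof. by move=> v; rewrite -[v]repK -piZ scale1r. Qed.

Fact qs_scaleDr : right_distributive qs_scale +%R.
Proof.
move=> a u v; rewrite -[u]repK -[v]repK -raddfD -!piZ -raddfD.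
by rewrite scalerDr.
Qed.

Fact qs_scaleDl v : {morph qs_scale^~ v : a b / a + b}.
Proof. by move=> a b; rewrite -[v]repK -!piZ -raddfD scalerDl. Qed.

HB.instance Definition _ := GRing.Zmodule_isLmodule.Build F qs_type
  qs_scaleA qs_scale1 qs_scaleDr qs_scaleDl.

HB.instance Definition _ := GRing.isScalable.Build F V qs_type *:%R pi piZ.

Definition quotient_space_of : quotient_space S :=
  {| qs_sort := qs_type; qs_pi := pi; qs_reprK := repK; qs_piP := piP |}.

End QuotientSpace.

Section FreeNovikov.

Variables (F : fieldType) (X : choiceType).

Local Notation magma := {malg F[word X]}.

Definition magma_mul (u v : magma) : magma :=
  lin_ext (fun a : word X => lin_ext (fun b : word X => << Op a b >>) v) u.

Lemma magma_mul_linl v : linear (magma_mul^~ v).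
Proof. by move=> a u1 u2; rewrite /magma_mul linearP. Qed.

Lemma magma_mul_linr u : linear (magma_mul u).
Proof.
move=> a v1 v2; rewrite /magma_mul !(lin_extE _ u) scaler_sumr -big_split /=.
by apply: eq_bigr => k _; rewrite linearP scalerDr !scalerA mulrC.
Qed.

Lemma magma_mulU a b : magma_mul << a >> << b >> = << Op a b >>.
Proof. by rewrite /magma_mul !lin_extU. Qed.

Local Notation "u ∘ v" := (magma_mul u v) (at level 40, left associativity).

(* The two-sided ideal generated by the Novikov identities. *)
Inductive in_nov_ideal : magma -> Prop :=
| nov_ideal_lsym x1 x2 x3 : in_nov_ideal
    (((x1 ∘ x2) ∘ x3 - x1 ∘ (x2 ∘ x3)) - ((x2 ∘ x1) ∘ x3 - x2 ∘ (x1 ∘ x3)))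
| nov_ideal_rcomm x1 x2 x3 : in_nov_ideal ((x1 ∘ x2) ∘ x3 - (x1 ∘ x3) ∘ x2)
| nov_ideal0 : in_nov_ideal 0
| nov_idealD u v : in_nov_ideal u -> in_nov_ideal v -> in_nov_ideal (u + v)
| nov_idealZ c u : in_nov_ideal u -> in_nov_ideal (c *: u)
| nov_idealMl u v : in_nov_ideal v -> in_nov_ideal (u ∘ v)
| nov_idealMr u v : in_nov_ideal u -> in_nov_ideal (u ∘ v).

Lemma nov_ideal_subspace : subspace in_nov_ideal.
Proof. by split; [exact: nov_ideal0|exact: nov_idealD|exact: nov_idealZ]. Qed.

End FreeNovikov.

(* Locked: unifying through the concrete quotient of finitely supported
   functions is very slow. nov_piP and nov_reprK characterise the quotient. *)
HB.lock Definition nov_quotient (F : fieldType) (X : choiceType) :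
    quotient_space (@in_nov_ideal F X) :=
  quotient_space_of (@nov_ideal_subspace F X).

Definition Nov (F : fieldType) (X : choiceType) : lmodType F :=
  qs_sort (nov_quotient F X).

Definition nov_pi (F : fieldType) (X : choiceType) :
  {linear {malg F[word X]} -> Nov F X} := qs_pi (nov_quotient F X).

Definition nov_repr (F : fieldType) (X : choiceType) :
  Nov F X -> {malg F[word X]} := @qs_repr _ _ _ (nov_quotient F X).

HB.lock Definition nov_mul (F : fieldType) (X : choiceType) (u v : Nov F X) :
    Nov F X :=
  nov_pi F X (magma_mul (nov_repr u) (nov_repr v)).

Definition nov_gen (F : fieldType) (X : choiceType) (x : X) : Nov F X :=
  nov_pi F X << Letter x >>.

Definition nov_eval (F : fieldType) (X : choiceType) : word X -> Nov F X :=
  word_eval (@nov_mul F X) (@nov_gen F X).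

Section NovAlgebra.

Variables (F : fieldType) (X : choiceType).

Local Notation magma := {malg F[word X]}.
Local Notation Nov := (Nov F X).
Local Notation nov_pi := (nov_pi F X).
Local Notation "u ∘ v" := (magma_mul u v) (at level 40, left associativity).

Lemma nov_reprK : cancel (@nov_repr F X) nov_pi.
Proof. exact: qs_reprK. Qed.

Lemma nov_piP (u v : magma) : nov_pi u = nov_pi v <-> in_nov_ideal (u - v).
Proof. exact: qs_piP. Qed.

Lemma nov_piM (u v : magma) : nov_pi (u ∘ v) = nov_mul (nov_pi u) (nov_pi v).
Proof.
have BK (w : magma) : in_nov_ideal (w - nov_repr (nov_pi w)).
  by apply/nov_piP; rewrite nov_reprK.
have mulBl (w w1 w2 : magma) : (w1 - w2) ∘ w = w1 ∘ w - w2 ∘ w.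
  by rewrite addrC -scaleN1r magma_mul_linl scaleN1r addrC.
have mulBr (w w1 w2 : magma) : w ∘ (w1 - w2) = w ∘ w1 - w ∘ w2.
  by rewrite addrC -scaleN1r magma_mul_linr scaleN1r addrC.
rewrite nov_mul.unlock; apply/nov_piP.
rewrite -(subrKA (nov_repr (nov_pi u) ∘ v)) -mulBl -mulBr.
by apply: nov_idealD; [apply: nov_idealMr|apply: nov_idealMl].
Qed.

Lemma nov_evalE (w : word X) : nov_eval F w = nov_pi << w >>.
Proof.
by elim: w => [//|u IHu v IHv]; rewrite -magma_mulU nov_piM -IHu -IHv.
Qed.

Lemma Nov_novikov : novikov (@nov_mul F X).
Proof.
split.
- move=> v a u1 u2; rewrite -[v]nov_reprK -[u1]nov_reprK -[u2]nov_reprK.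
  by rewrite -linearP -!nov_piM magma_mul_linl linearP.
- move=> u a v1 v2; rewrite -[u]nov_reprK -[v1]nov_reprK -[v2]nov_reprK.
  by rewrite -linearP -!nov_piM magma_mul_linr linearP.
- move=> x1 x2 x3; rewrite -[x1]nov_reprK -[x2]nov_reprK -[x3]nov_reprK.
  by rewrite -!nov_piM -!linearB; apply/nov_piP/nov_ideal_lsym.
- move=> x1 x2 x3; rewrite -[x1]nov_reprK -[x2]nov_reprK -[x3]nov_reprK.
  by rewrite -!nov_piM; apply/nov_piP/nov_ideal_rcomm.
Qed.

(* nov_lift, nov_lift_gen, nov_liftM and nov_lift_uniq are the universal
   property that makes Nov the free Novikov algebra generated by X. *)
Section Universal.

Variables (A : lmodType F) (m : A -> A -> A) (i : X -> A).
Hypothesis novm : novikov m.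

Local Notation ev := (lin_ext (word_eval m i)).

Lemma magma_evalM u v : ev (u ∘ v) = m (ev u) (ev v).
Proof.
rewrite (lin_ext_comp _ u (nov_linl novm (ev v))) /magma_mul.
rewrite (lin_ext_comp _ u (linearP ev)); congr lin_ext; apply/funext => a /=.
rewrite (lin_ext_comp _ v (linearP ev)).
rewrite (lin_ext_comp _ v (nov_linr novm (word_eval m i a))).
by congr lin_ext; apply/funext => b /=; rewrite lin_extU.
Qed.

Lemma magma_eval_ideal u : in_nov_ideal u -> ev u = 0.
Proof.
have m0l v : m 0 v = 0.
  by have := nov_linl novm v (-1) 0 0; rewrite scaler0 addr0 scaleN1r addNr.
have m0r v : m v 0 = 0.
  by have := nov_linr novm v (-1) 0 0; rewrite scaler0 addr0 scaleN1r addNr.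
elim=> {u} [x1 x2 x3|x1 x2 x3||u v _ evu _ evv|c u _ evu|u v _ evv|u v _ evu].
- by rewrite !linearB /= !magma_evalM (nov_lsym novm) -opprD subrr.
- by rewrite linearB /= !magma_evalM (nov_rcomm novm) subrr.
- by rewrite linear0.
- by rewrite linearD /= evu evv addr0.
- by rewrite linearZ /= evu scaler0.
- by rewrite magma_evalM evv m0r.
- by rewrite magma_evalM evu m0l.
Qed.

Definition nov_lift (u : Nov) : A := ev (nov_repr u).

Lemma nov_lift_pi (u : magma) : nov_lift (nov_pi u) = ev u.
Proof.
apply/eqP; rewrite -subr_eq0 /nov_lift -linearB /=; apply/eqP.
by apply/magma_eval_ideal/nov_piP; rewrite nov_reprK.
Qed.

Fact nov_lift_linear : linear nov_lift.
Proof.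
move=> a u v; rewrite -[u]nov_reprK -[v]nov_reprK -(linearP nov_pi).
by rewrite !nov_lift_pi linearP.
Qed.

Lemma nov_lift_gen x : nov_lift (nov_gen F x) = i x.
Proof. by rewrite nov_lift_pi lin_extU. Qed.

Lemma nov_liftM u v : nov_lift (nov_mul u v) = m (nov_lift u) (nov_lift v).
Proof. by rewrite nov_mul.unlock nov_lift_pi magma_evalM. Qed.

Lemma nov_lift_uniq (f : Nov -> A) : linear f ->
    (forall u v, f (nov_mul u v) = m (f u) (f v)) ->
    (forall x, f (nov_gen F x) = i x) ->
  f =1 nov_lift.
Proof.
move=> fL fM fX u; rewrite -[u]nov_reprK nov_lift_pi.
move: (nov_repr u) => {u} u.
have fpL : linear (f \o nov_pi) by move=> a v w /=; rewrite linearP fL.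
have -> : u = lin_ext (fun w : word X => << w >>) u.
  by rewrite lin_ext_id.
rewrite -[LHS]/((f \o nov_pi) _) (lin_ext_comp _ _ fpL).
rewrite (lin_ext_comp _ _ (linearP ev)).
congr lin_ext; apply/funext => w /=; rewrite lin_extU -nov_evalE.
by elim: w => [x|w1 IH1 w2 IH2] /=; rewrite ?fX // fM IH1 IH2.
Qed.

End Universal.

End NovAlgebra.

Section NormalForms.

Variables (disp : Order.disp_t) (X : orderType disp).

(* The pair (x, r) stands for the letter x^(r). *)
Local Notation letter := (X * nat)%type.

Definition letter_le (a b : letter) : bool :=
  (a.2 < b.2)%N || (a.2 == b.2) && (a.1 <= b.1)%O.

(* A sequence of letters stands for the product of its entries, so two
   sequences denote the same differential monomial iff they are permutations
   of each other. *)
Definition wt (w : seq letter) : int := \sum_(a <- w) (a.2%:Z - 1).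

(* c_1 c_2 ... c_l y_N^(s_N) ... y_1^(s_1), with c_1 stored apart from
   c_2 ... c_l because l >= 1, and the last group in the written order, from
   y_N^(s_N) down to y_1^(s_1). *)
Record diffword : Type := DiffWord {
  dw_head : X;
  dw_tail : seq X;
  dw_pos : seq letter
}.

Definition dw_letters (a : diffword) : seq letter :=
  [seq (c, 0%N) | c <- dw_head a :: dw_tail a] ++ dw_pos a.

(* The weight condition amounts to l = 1 + \sum_i (s_i - 1): see wtN1E. By
   normal_form_exists and normal_form_uniq every differential monomial of
   weight -1 has exactly one normal form. *)
Definition normal_forms : set diffword :=
  [set a | [/\ sorted (fun c c' : X => c <= c')%O (dw_head a :: dw_tail a),
               sorted (fun b b' => letter_le b' b) (dw_pos a),
               all (fun b : letter => 1 <= b.2)%N (dw_pos a) &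
               wt (dw_letters a) = -1]].

Lemma wtN1E (a : diffword) : all (fun b : letter => 1 <= b.2)%N (dw_pos a) ->
  (wt (dw_letters a) == -1) =
  (size (dw_head a :: dw_tail a) == 1 + \sum_(b <- dw_pos a) (b.2 - 1))%N.
Proof.
move=> pos; rewrite /wt big_cat big_map /=.
rewrite (eq_bigr (fun=> -1)) // big_const_seq count_predT -/(size _) iter_addr_0.
have -> : \sum_(b <- dw_pos a) (b.2%:Z - 1)
          = (\sum_(b <- dw_pos a) (b.2 - 1))%N%:Z.
  rewrite (big_morph _ PoszD (erefl _)) big_seq [RHS]big_seq.
  by apply: eq_bigr => b /(allP pos) b1; rewrite subzn.
rewrite /=; set S := (\sum_(b <- _) _)%N.
lia.
Qed.

Lemma letter_le_anti : antisymmetric letter_le.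
Proof.
move=> [x r] [y s]; rewrite /letter_le /=.
case: (ltngtP r s) => //= -> /le_anti; by move=> ->.
Qed.

Lemma letter_le_trans : transitive letter_le.
Proof.
move=> [y s] [x r] [z t]; rewrite /letter_le /=.
case: (ltngtP r s) => //= [rs _|->].
  by case: (ltngtP s t) => //= [st|<-]; rewrite ?(ltn_trans rs st) ?rs.
by move=> xy; case: (ltngtP s t) => //= _; apply: le_trans.
Qed.

Lemma letter_le_total : total letter_le.
Proof.
move=> [x r] [y s]; rewrite /letter_le /=.
by case: (ltngtP r s) => //= _; apply: le_total.
Qed.

Lemma normal_form_exists (w : seq letter) : wt w = -1 ->
  exists2 a, normal_forms a & perm_eq (dw_letters a) w.
Proof.
move=> wtw.
pose cs := sort (fun c c' : X => c <= c')%O [seq b.1 | b : letter <- w & b.2 == 0%N].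
pose ys := sort (fun b b' => letter_le b' b) [seq b <- w | b.2 != 0%N].
have pw : perm_eq ([seq (c, 0%N) | c <- cs] ++ ys) w.
  apply: perm_trans (permEl (perm_filterC (fun b : letter => b.2 == 0%N) w)).
  apply: perm_cat; last by rewrite perm_sort.
  have -> : [seq b <- w | b.2 == 0%N] =
            [seq (c, 0%N) | c <- [seq b.1 | b : letter <- w & b.2 == 0%N]].
    rewrite -map_comp -[LHS]map_id; apply/eq_in_map => -[x r] /=.
    by rewrite mem_filter => /andP [/eqP /= ->].
  by apply: perm_map; rewrite perm_sort.
have pos : all (fun b : letter => 1 <= b.2)%N ys.
  by apply/allP => b; rewrite mem_sort mem_filter lt0n => /andP [].
have wtcs : wt ([seq (c, 0%N) | c <- cs] ++ ys) = -1.
  by rewrite -wtw; apply: perm_big.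
have srt : sorted (fun c c' : X => c <= c')%O cs by apply/sort_sorted/le_total.
case: cs pw wtcs srt => [|c cs] pw wtcs srt; last first.
  exists (DiffWord c cs ys) => //; split=> //.
  by apply: sort_sorted => b b'; apply: letter_le_total.
suff: 0 <= wt ys by rewrite -[ys]cat0s wtcs.
rewrite /wt big_seq; apply: sumr_ge0 => b /(allP pos) b1; lia.
Qed.

Lemma normal_form_uniq (a b : diffword) : normal_forms a -> normal_forms b ->
  perm_eq (dw_letters a) (dw_letters b) -> a = b.
Proof.
case: a b => [c cs ys] [c' cs' ys'] [/= sc sy py _] [/= sc' sy' py' _].
move: sc sc'; set C := c :: cs; set C' := c' :: cs' => sc sc'.
rewrite -[dw_letters (DiffWord c _ _)]/([seq (d, 0%N) | d <- C] ++ ys).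
rewrite -[dw_letters (DiffWord c' _ _)]/([seq (d, 0%N) | d <- C'] ++ ys') => pab.
have filt0 (D : seq X) zs : all (fun b : letter => 1 <= b.2)%N zs ->
    [seq b <- [seq (d, 0%N) | d <- D] ++ zs | b.2 == 0%N] = [seq (d, 0%N) | d <- D].
  move=> pz; rewrite filter_cat filter_map (eq_filter (a2 := predT)) //.
  rewrite filter_predT -[RHS]cats0; congr cat; apply/eqP.
  rewrite -size_eq0 size_filter -leqn0 leqNgt -has_count; apply/hasPn => b /(allP pz).
  by rewrite lt0n.
have filt1 (D : seq X) zs : all (fun b : letter => 1 <= b.2)%N zs ->
    [seq b <- [seq (d, 0%N) | d <- D] ++ zs | b.2 != 0%N] = zs.
  move=> pz; rewrite filter_cat filter_map (eq_filter (a2 := pred0)) //.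
  rewrite filter_pred0 /=; apply/all_filterP; apply/allP => b /(allP pz).
  by rewrite lt0n.
have eC : C = C'.
  apply: (sorted_eq le_trans le_anti) => //.
  have := perm_filter (fun b : letter => b.2 == 0%N) pab.
  by rewrite !filt0 //; apply: perm_map_inj => x y [].
have eY : ys = ys'.
  apply: (sorted_eq (leT := fun b b' => letter_le b' b)) => //.
  - by move=> y x z xy yz; apply: letter_le_trans yz xy.
  - by move=> x y /andP [xy yx]; apply: letter_le_anti; rewrite xy yx.
  by have := perm_filter (fun b : letter => b.2 != 0%N) pab; rewrite !filt1.
by rewrite eY; case: eC => -> ->.
Qed.

(* c :: cs is the list of the c_i, and drop k cl its last s entries. The default
   value B of head is never used, since cl' is nonempty. *)
Fixpoint phi_rec (c : word X) (cs : seq (word X)) (ys : seq letter) : word X :=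
  match ys with
  | [::] => c
  | (y, s) :: ys' =>
      let cl := c :: cs in
      let k := (size cl - s)%N in
      let B := foldl (fun b c' => Op c' b) (Letter y) (drop k cl) in
      let cl' := rcons (take k cl) B in
      phi_rec (head B cl') (behead cl') ys'
  end.

Definition phi (a : diffword) : word X :=
  phi_rec (Letter (dw_head a)) (map Letter (dw_tail a)) (dw_pos a).

Lemma phi_example (x y z t q : X) :
  phi (DiffWord x [:: y] [:: (z, 2); (t, 1); (q, 1)]%N) =
  Op (Op (Op (Letter y) (Op (Letter x) (Letter z))) (Letter t)) (Letter q).
Proof. by []. Qed.

End NormalForms.

Arguments normal_forms {disp} X _.

(* Main.v *)
(** The product u ∘ v = u d(v) makes differential polynomials a Novikov algebra,
    in which φ(a) is the monomial a plus monomials with more differentiated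
    letters than a: in d(c ∘ w) the terms that differentiate c contain two
    differentiated letters. Comparing coefficients at the normal forms with
    fewest differentiated letters gives linear independence.

    For spanning, the elements c R_{v_1} ... R_{v_N}, where c is a letter and
    the v_i are right-normed words, span a subspace closed under left
    multiplications, hence under ∘. The right multiplications R_{v_i} commute,
    and exchanging two of the letters c and those inside the v_i, except the
    last letter of a v_i, changes the element only by such elements of the same
    degree with more factors v_i. So downward induction on N reduces every
    element to the sorted ones, which are the φ(a). *)

Require Import Defs.
From HB Require Import structures.
From mathcomp Require Import all_boot all_order all_algebra.
From mathcomp Require Import boolp classical_sets.
From mathcomp Require Import finmap monalg.
From mathcomp Require Import zify ring.

Set Implicit Arguments.
Unset Strict Implicit.
Unset Printing Implicit Defensive.

Import Order.TTheory GRing.Theory.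

Local Open Scope ring_scope.
Local Open Scope classical_set_scope.

(** * Linear spans, and exchanges of entries in lists *)

Section Span.

Variables (F : fieldType) (V : lmodType F).

Inductive lspan (S : V -> Prop) : V -> Prop :=
| lspan_gen v of S v : lspan S v
| lspan0 : lspan S 0
| lspanD u v of lspan S u & lspan S v : lspan S (u + v)
| lspanZ c u of lspan S u : lspan S (c *: u).

Lemma lspanN S u : lspan S u -> lspan S (- u).
Proof. by move=> Su; rewrite -scaleN1r; apply: lspanZ. Qed.

Lemma lspanB S u v : lspan S u -> lspan S v -> lspan S (u - v).
Proof. by move=> Su Sv; apply/lspanD/lspanN. Qed.

Lemma lspan_sum S (I : Type) (r : seq I) (f : I -> V) :
  (forall j, lspan S (f j)) -> lspan S (\sum_(j <- r) f j).
Proof.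
move=> Sf; apply: big_ind => //; [exact: lspan0|exact: lspanD].
Qed.

Lemma lspan_sub (S T : V -> Prop) :
  (forall v, S v -> lspan T v) -> forall u, lspan S u -> lspan T u.
Proof.
move=> ST u; elim=> {u} [u /ST//||u v _ Tu _ Tv|c u _ Tu].
- exact: lspan0.
- exact: lspanD.
- exact: lspanZ.
Qed.

(** [spanning] attaches coefficients to vectors, so repeated vectors must be merged. Lists of
    coefficient-vector pairs follow the constructors of [lspan] directly; the coefficients of equal
    vectors are added up afterwards. *)
Lemma lspan_lin_comb S u : lspan S u ->
  exists (s : seq V) (k : V -> F),
    (forall v, v \in s -> S v) /\ u = \sum_(v <- s) k v *: v.
Proof.
move=> Su; suff [t [St ->]] : exists t : seq (F * V),
    (forall p, p \in t -> S p.2) /\ u = \sum_(p <- t) p.1 *: p.2.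
  exists (undup [seq p.2 | p <- t]), (fun v => \sum_(p <- t | p.2 == v) p.1).
  split=> [v|]; first by rewrite mem_undup => /mapP[p /St Sp ->].
  under [RHS]eq_bigr do rewrite scaler_suml.
  rewrite (exchange_big_dep predT) //= big_seq [RHS]big_seq.
  apply: eq_bigr => p pt; under eq_bigl do rewrite eq_sym.
  rewrite -big_filter filter_pred1_uniq ?undup_uniq ?big_seq1 //.
  by rewrite mem_undup; apply/mapP; exists p.
elim: Su => {u} [u Su||u v _ [s [Ss ->]] _ [t [St ->]]|c u _ [s [Ss ->]]].
- exists [:: (1, u)]; split; last by rewrite big_seq1 scale1r.
  by move=> p; rewrite inE => /eqP ->.
- by exists [::]; split=> //; rewrite big_nil.
- exists (s ++ t); split; last by rewrite big_cat.
  by move=> p; rewrite mem_cat => /orP[/Ss|/St].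
- exists [seq (c * p.1, p.2) | p <- s]; split.
    by move=> _ /mapP[p /Ss Sp ->].
  by rewrite big_map scaler_sumr; apply: eq_bigr => p _; rewrite scalerA.
Qed.

End Span.

Lemma lspan_linear (F : fieldType) (V W : lmodType F) (S : V -> Prop)
    (T : W -> Prop) (f : V -> W) : linear f ->
  (forall v, S v -> lspan T (f v)) -> forall u, lspan S u -> lspan T (f u).
Proof.
move=> fL ST u.
have f0 : f 0 = 0 by have := fL (-1) 0 0; rewrite scaler0 addr0 scaleN1r addNr.
elim=> {u} [u /ST//||u v _ Tu _ Tv|c u _ Tu].
- by rewrite f0; apply: lspan0.
- by rewrite -[u]scale1r fL scale1r; apply: lspanD.
- by rewrite -[_ *: u]addr0 fL f0 addr0; apply: lspanZ.
Qed.

(** The exchanges of the first entry with a later one generate all permutations. *)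
Lemma perm_exchange_head (X : eqType) (A : Type) (R : A -> A -> Prop) (k : nat)
    (f : X -> seq X -> A) :
    (forall x, R x x) -> (forall x y z, R x y -> R y z -> R x z) ->
    (forall a b h1 h2, size (h1 ++ b :: h2) = k ->
       R (f a (h1 ++ b :: h2)) (f b (h1 ++ a :: h2))) ->
  forall a b h h', size h = k -> perm_eq (a :: h) (b :: h') -> R (f a h) (f b h').
Proof.
(* The entries of [pre] are already in their final places; the head is the buffer through which the
   next entry [d] of the target is put in place. *)
move=> Rxx Rt Rf a b h h'; rewrite -{2}[h']cat0s -{1 3}[h]cat0s; move: [::] => pre.
have [n] := ubnP (size h'); elim: n => // n IHn in pre a h h' *.
case: h' => [|d h'].
  case: h => [|e h] _ _ => [pab|/perm_size//].
  have : a \in [:: b] by rewrite -(perm_mem pab) mem_head.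
  by rewrite inE => /eqP ->.
rewrite ltnS => h'n; case: h => [|e h] sz; first by move/perm_size.
move=> pah.
have step x h1 : size (pre ++ d :: h1) = k -> perm_eq (x :: d :: h1) [:: b, d & h'] ->
    R (f x (pre ++ d :: h1)) (f b (pre ++ d :: h')).
  move=> szx px; rewrite -!cat_rcons; apply: IHn => //.
    by rewrite cat_rcons.
  rewrite -(perm_cons d) (perm_trans _ (perm_trans px _)) //.
    by rewrite (perm_catCA [:: d] [:: x] h1).
  by rewrite (perm_catCA [:: b] [:: d] h').
case: (eqVneq e d) sz pah => [-> {e}|ned] sz pah; first exact: step.
have [ead|nad] := eqVneq a d.
  subst d; apply: Rt (Rf _ _ _ _ _) _ => //.
  apply: step; first by rewrite -sz !size_cat.
  by rewrite (perm_trans _ pah) // (perm_catCA [:: e] [:: a] h).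
have : d \in a :: e :: h by rewrite (perm_mem pah) !inE eqxx orbT.
rewrite !inE eq_sym (negPf nad) eq_sym (negPf ned) /=.
move=> dh; case/splitPr: h / dh sz pah => h1 h2 sz pah.
(* [d] goes first into the head, then into the place of [e]. *)
have := Rf a d (pre ++ e :: h1) h2; rewrite -!catA /= => /(_ sz)/Rt; apply.
have := Rf d e pre (h1 ++ a :: h2) => /(_ _)/Rt; apply.
  by rewrite -sz !size_cat /= !size_cat.
apply: step; first by rewrite -sz !size_cat /= !size_cat.
apply: perm_trans pah; apply/permP => p /=; rewrite !count_cat /=; lia.
Qed.

(** * Right-normed words and right multiplications in a Novikov algebra *)

Section Novikov.

Variables (F : fieldType) (A : lmodType F) (m : A -> A -> A).
Hypothesis novm : novikov m.

Fact novBl u v w : m (u - v) w = m u w - m v w.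
Proof. by rewrite addrC -scaleN1r (nov_linl novm) scaleN1r addrC. Qed.

Fact novBr u v w : m w (u - v) = m w u - m w v.
Proof. by rewrite addrC -scaleN1r (nov_linr novm) scaleN1r addrC. Qed.

Lemma nov_lsym_assoc a b c : m a (m b c) - m (m a b) c = m b (m a c) - m (m b a) c.
Proof. by rewrite -opprB (nov_lsym novm) opprB. Qed.

(* With the product a d(b), both sides are d a b' q''. *)
Lemma nov_assocM a b d q :
  m d (m (m a b) q) - m (m d (m a b)) q = m (m d (m a q) - m (m d a) q) b.
Proof.
rewrite nov_lsym_assoc (nov_rcomm novm a b (m d q)).
rewrite (nov_rcomm novm a b d) (nov_rcomm novm (m a d) b q).
by rewrite -novBl nov_lsym_assoc.
Qed.

Variables (X : eqType) (i : X -> A).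

(* The pair (cs, y) stands for the right-normed word c_1 ∘ (c_2 ∘ (... ∘ y)). *)
Local Notation part := (seq X * X)%type.

Definition rnormed (p : part) : A := foldr (fun c w => m (i c) w) (i p.2) p.1.

Definition rmulp (u : A) (l : seq part) : A :=
  foldr (fun p w => m w (rnormed p)) u l.

(** This omits the starting letter: [rmulp (i c) l] has degree [(degp l).+1]. *)
Definition degp (l : seq part) : nat := sumn [seq (size p.1).+1 | p <- l].

Lemma degp_cat l1 l2 : degp (l1 ++ l2) = (degp l1 + degp l2)%N.
Proof. by rewrite /degp map_cat sumn_cat. Qed.

Lemma rmulp_cat u l1 l2 : rmulp u (l1 ++ l2) = rmulp (rmulp u l2) l1.
Proof. exact: foldr_cat. Qed.

Lemma rmulp_mulr u l v : m (rmulp u l) v = rmulp (m u v) l.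
Proof. by elim: l => //= p l <-; rewrite (nov_rcomm novm). Qed.

Lemma rmulp_perm u (X' : eqType) (f : X' -> part) (l1 l2 : seq X') :
  perm_eq l1 l2 -> rmulp u (map f l1) = rmulp u (map f l2).
Proof.
elim: l1 => [|p l1 IHl] in l2 *; first by rewrite perm_sym => /perm_nilP ->.
move=> /[dup] /perm_mem/(_ p); rewrite mem_head => /esym.
case/splitPr => l3 l4; rewrite (perm_sym (p :: l1)).
rewrite (perm_catCA l3 [:: p] l4) perm_cons perm_sym => /IHl /= ->.
by rewrite !map_cat !rmulp_cat /= rmulp_mulr.
Qed.

Lemma rmulp_linear l : linear (rmulp^~ l).
Proof. by move=> c u v; elim: l => //= p l ->; rewrite (nov_linl novm). Qed.

Lemma rmulpB u v l : rmulp (u - v) l = rmulp u l - rmulp v l.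
Proof. by rewrite addrC -scaleN1r rmulp_linear scaleN1r addrC. Qed.

(** By [nov_assocM], the map sending [u] to [m d (m u q) - m (m d u) q] commutes with right
    multiplications, so the factors of [l] come out one by one. *)
Lemma mul_rmulp c d q l :
  m d (m (rmulp c l) q) =
  m (m d (rmulp c l)) q + rmulp (m d (m c q) - m (m d c) q) l.
Proof.
apply/esym/eqP; rewrite eq_sym addrC -subr_eq; apply/eqP.
by elim: l => //= p l IHl; rewrite nov_assocM IHl.
Qed.

(** A decreasing filtration by the number of factors, at a fixed degree. Each factor has at least
    one letter, so it becomes zero for [N > n]; this makes downward induction possible. *)
Definition pspan (N n : nat) : A -> Prop :=
  lspan (fun u => exists c l,
    [/\ (N <= size l)%N, degp l = n & u = rmulp (i c) l]).

Lemma pspan_gen N n c l :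
  (N <= size l)%N -> degp l = n -> pspan N n (rmulp (i c) l).
Proof. by move=> Nl nl; apply: lspan_gen; exists c, l. Qed.

Lemma pspan_leq N N' n u : (N <= N')%N -> pspan N' n u -> pspan N n u.
Proof.
move=> NN'; apply: lspan_sub => _ [c [l [N'l nl ->]]].
exact: pspan_gen (leq_trans NN' N'l) nl.
Qed.

Lemma pspan_rmulp N n u l :
  pspan N n u -> pspan (N + size l) (n + degp l) (rmulp u l).
Proof.
apply: (lspan_linear (rmulp_linear l)) => _ [c [l' [Nl' <- ->]]].
rewrite -rmulp_cat; apply: pspan_gen; first by rewrite size_cat addnC leq_add2l.
by rewrite degp_cat addnC.
Qed.

(** Induction on the factors with [mul_rmulp]. Of the two correction terms, one absorbs [c] into the
    right-normed word [q] and the other makes [c] a factor of its own; neither has fewer factors. *)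
Lemma pspan_mull N n d u : pspan N n u -> pspan N n.+1 (m (i d) u).
Proof.
apply: (lspan_linear (nov_linr novm (i d))) => _ [c [l [Nl <- ->]]] {n}.
apply: pspan_leq Nl _.
elim: l => [|q l IHl].
  by apply: (@pspan_gen 0 1 d [:: ([::], c)]).
rewrite [rmulp _ _]/= mul_rmulp; apply: lspanD.
  have := @pspan_rmulp _ _ _ [:: q] IHl.
  by rewrite addn1 addSn addnC /degp /= addn0.
rewrite rmulpB; apply: lspanB.
  have -> : rmulp (m (i d) (m (i c) (rnormed q))) l =
      rmulp (i d) (l ++ [:: (c :: q.1, q.2)]) by rewrite rmulp_cat.
  apply: pspan_gen; first by rewrite size_cat addn1.
  by rewrite degp_cat /degp /=; lia.
have -> : rmulp (m (m (i d) (i c)) (rnormed q)) l =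
    rmulp (i d) (l ++ [:: q; ([::], c)]) by rewrite rmulp_cat.
apply: pspan_gen; first by rewrite size_cat addn2.
by rewrite degp_cat /degp /=; lia.
Qed.

(** By right commutativity the factors of [u] act after the multiplication by [v], which leaves a
    left multiplication by a single letter. *)
Lemma pspan_mul N n N' n' u v :
  pspan N n u -> pspan N' n' v -> pspan (N + N') (n + n').+1 (m u v).
Proof.
move=> Nu Nv; move: u Nu.
apply: (lspan_linear (nov_linl novm v)) => _ [c [l [Nl <- ->]]].
rewrite rmulp_mulr.
have := pspan_rmulp l (pspan_mull c Nv).
by rewrite addSn addnC [(n' + _)%N]addnC; apply: pspan_leq; rewrite leq_add2r.
Qed.

(** Left symmetry turns the difference into [(a ∘ b) ∘ p - (b ∘ a) ∘ p], where each term has two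
    factors. *)
Lemma pspan_comm a b p :
  pspan 2 (size p.1).+2 (m (i a) (m (i b) (rnormed p)) - m (i b) (m (i a) (rnormed p))).
Proof.
have -> : m (i a) (m (i b) (rnormed p)) - m (i b) (m (i a) (rnormed p)) =
    rmulp (i a) [:: p; ([::], b)] - rmulp (i b) [:: p; ([::], a)].
  have /eqP := nov_lsym_assoc (i a) (i b) (rnormed p).
  by rewrite subr_eq => /eqP ->; rewrite addrC -addrA addKr addrC.
by apply: lspanB; apply: pspan_gen => //; rewrite /degp /=; lia.
Qed.

(** Modulo two factors, [a] moves inside past [d], is exchanged with [b] by induction, and [b] moves
    out past [d]. *)
Lemma pspan_exchange a b cs1 cs2 y :
  pspan 2 (size cs1 + size cs2).+2 (m (i a) (rnormed (cs1 ++ b :: cs2, y))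
    - m (i b) (rnormed (cs1 ++ a :: cs2, y))).
Proof.
elim: cs1 => [|d cs1 IHcs] /=; first exact: pspan_comm a b (cs2, y).
set u := (cs1 ++ b :: cs2, y) in IHcs *; set v := (cs1 ++ a :: cs2, y) in IHcs *.
rewrite -[X in X - _](subrK (m (i d) (m (i a) (rnormed u)))) -addrA.
apply: lspanD.
  by have := pspan_comm a d u; rewrite size_cat /= addnS.
rewrite -[X in X - _](subrK (m (i d) (m (i b) (rnormed v)))) -addrA.
apply: lspanD; first by rewrite -novBr; apply: pspan_mull.
by have := pspan_comm d b v; rewrite size_cat /= addnS.
Qed.

(** A letter [y^(s)] takes only [s.-1] entries of [h]: the first of the [s] words that φ puts before
    [y] is the element on which the part acts by right multiplication. *)
Fixpoint blocks (h : seq X) (ys : seq (X * nat)) : seq part :=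
  if ys is (y, s) :: ys' then
    (take s.-1 h, y) :: blocks (drop s.-1 h) ys'
  else [::].

Lemma size_blocks h ys : size (blocks h ys) = size ys.
Proof. by elim: ys h => //= -[y s] ys IHys h /=; rewrite IHys. Qed.

(** The witnesses are chosen before [b'], so replacing an entry of [h] changes one part only, and
    not its last letter. *)
Lemma blocks_split h1 b h2 ys :
    size (h1 ++ b :: h2) = (\sum_(p <- ys) p.2.-1)%N ->
  exists l1 l2 cs1 cs2 y, forall b',
    blocks (h1 ++ b' :: h2) ys = l1 ++ (cs1 ++ b' :: cs2, y) :: l2.
Proof.
elim: ys => [|[y s] ys IHys] in h1 *; first by rewrite big_nil size_cat addnS.
rewrite big_cons /= => sz; have [sh1|h1s] := leqP s.-1 (size h1).
  have [|l1 [l2 [cs1 [cs2 [z IH]]]]] := IHys (drop s.-1 h1).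
    by move: sz; rewrite !size_cat size_drop; lia.
  exists ((take s.-1 h1, y) :: l1), l2, cs1, cs2, z => b' /=.
  rewrite takel_cat // -IH drop_cat; case: ltngtP sh1 => // -> _.
  by rewrite subnn drop0 drop_size.
exists [::], (blocks (drop (s.-1 - size h1).-1 h2) ys).
exists h1, (take (s.-1 - size h1).-1 h2), y => b'.
rewrite take_cat drop_cat ltnNge (ltnW h1s) /=.
by have -> : (s.-1 - size h1)%N = (s.-1 - size h1).-1.+1 by lia.
Qed.

Lemma degp_blocks h ys : all (fun p => 0 < p.2)%N ys ->
    size h = (\sum_(p <- ys) p.2.-1)%N ->
  degp (blocks h ys) = (\sum_(p <- ys) p.2)%N.
Proof.
rewrite /degp; elim: ys => [|[y s] ys IHys] in h *; first by rewrite !big_nil.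
rewrite !big_cons /= => /andP[s0 pos] sz.
rewrite IHys //; last by rewrite size_drop sz addKn.
by rewrite size_takel ?sz ?leq_addr // prednK.
Qed.

(** [perm_exchange_head] is applied to congruence modulo elements with an additional factor: by
    [pspan_exchange], an exchange replaces one part by at least two. *)
Lemma pspan_blocks_perm a b h h' ys : all (fun p => 0 < p.2)%N ys ->
    size h = (\sum_(p <- ys) p.2.-1)%N -> perm_eq (a :: h) (b :: h') ->
  pspan (size ys).+1 (\sum_(p <- ys) p.2)%N
    (rmulp (i a) (blocks h ys) - rmulp (i b) (blocks h' ys)).
Proof.
move=> pos; set k := (\sum_(p <- ys) p.2.-1)%N; set n := (\sum_(p <- ys) p.2)%N.
move: a b h h'; apply: (perm_exchange_head (k := k)
  (R := fun u v => pspan (size ys).+1 n (u - v))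
  (f := fun a h => rmulp (i a) (blocks h ys))).
- by move=> u; rewrite subrr; apply: lspan0.
- by move=> u v w uv vw; rewrite -(subrK v u) -addrA; apply: lspanD.
move=> a b h1 h2 sz.
have [l1 [l2 [cs1 [cs2 [y E]]]]] := blocks_split sz.
have := degp_blocks pos sz; have := size_blocks (h1 ++ b :: h2) ys; rewrite !E.
rewrite degp_cat size_cat /= addnS => <- degE.
(* The part that changes is moved innermost; the others are common right multiplications. *)
rewrite !rmulp_cat /= !rmulp_mulr -rmulp_cat -rmulp_cat -rmulpB.
have -> : (size l1 + size l2).+2 = (2 + size (l1 ++ l2))%N by rewrite size_cat.
have -> : n = ((size cs1 + size cs2).+2 + degp (l1 ++ l2))%N.
  by rewrite /n -degE degp_cat /degp /= size_cat /=; lia.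
exact/pspan_rmulp/pspan_exchange.
Qed.

End Novikov.

(** * Evaluation of φ, and spanning *)

Section PhiEval.

Variables (F : fieldType) (A : lmodType F) (m : A -> A -> A).
Hypothesis novm : novikov m.
Variables (disp : Order.disp_t) (X : orderType disp) (i : X -> A).

Local Notation ev := (word_eval m i).
Local Notation letter := (X * nat)%type.

(** φ consumes its list from the end, so [h] is stored reversed, and [w] is the last word, the only
    one that need not be a letter. As [L] is nonempty, the default of [head] does not matter. Each
    new part lands innermost, and right commutativity moves it to the order of [rmulp]. *)
Lemma word_eval_phi_rec (ys : seq letter) (w : word X) (h : seq X) :
    all (fun p => 0 < p.2)%N ys -> size h = (\sum_(p <- ys) p.2.-1)%N ->
  let L := rcons (map Letter (rev h)) w in
  ev (phi_rec (head w L) (behead L) ys) = rmulp m i (ev w) (blocks h ys).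
Proof.
elim: ys => [|[y s] ys IHys] in w h *.
  by rewrite big_nil => _ /size0nil ->.
rewrite big_cons => /= /andP[s0 pos] sz.
set L := rcons _ w.
have -> : head w L :: behead L = L by rewrite /L; case: (map _ _).
(* [w] is one of the [s] words consumed, because [s > 0]; hence [s.-1] on the side of [h]. *)
have kE : ((size L) - s)%N = (size h - s.-1)%N.
  by rewrite size_rcons size_map size_rev; lia.
have sh : (size h - (size h - s.-1))%N = s.-1 by lia.
have kL : (size h - s.-1 <= size (map (@Letter X) (rev h)))%N.
  by rewrite size_map size_rev leq_subr.
have -> : (size (behead L)).+1 = size L by rewrite size_behead size_rcons.
rewrite kE /L drop_rcons // -cats1 foldl_cat /=.
rewrite -[X in take _ X]cats1 takel_cat // -!(map_drop, map_take).
rewrite drop_rev take_rev sh !map_rev foldl_rev -map_rev.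
rewrite IHys //; last by rewrite size_drop sz addKn.
rewrite /= rmulp_mulr //; congr (rmulp _ _ (m _ _) _).
by elim: (take _ _) => //= c cs ->.
Qed.

Lemma word_eval_phi (a : diffword X) (c : X) (h : seq X) :
    all (fun p => 0 < p.2)%N (dw_pos a) ->
    size h = (\sum_(p <- dw_pos a) p.2.-1)%N ->
    dw_head a :: dw_tail a = rev (c :: h) ->
  ev (phi a) = rmulp m i (i c) (blocks h (dw_pos a)).
Proof.
case: a => b bs ys /= pos sz E.
have := word_eval_phi_rec (Letter c) pos sz.
by rewrite -map_rcons -rev_cons -E.
Qed.

Lemma normal_size (a : diffword X) : normal_forms X a ->
  size (dw_tail a) = (\sum_(p <- dw_pos a) p.2.-1)%N.
Proof.
case=> _ _ pos /eqP; rewrite (wtN1E pos) /= => /eqP[->].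
by apply: eq_bigr => p _; rewrite subn1.
Qed.

Local Notation phi_vals := (fun u => exists2 a, normal_forms X a & u = ev (phi a)).

(** Sorting the parts costs nothing, and sorting the remaining letters costs terms of the same
    degree with more factors, which the induction covers. *)
Lemma lspan_rmulp c (l : seq (seq X * X)) : lspan phi_vals (rmulp m i (i c) l).
Proof.
(* [k] bounds the room for further factors; for [k = 0] there is none, by [degl]. *)
have [k] : exists k, (degp l < size l + k)%N by exists (degp l).+1; lia.
have degl (l' : seq (seq X * X)) : (size l' <= degp l')%N.
  by elim: l' => // p l'; rewrite /degp /=; lia.
elim: k => [|k IHk] in c l *; first by rewrite addn0 ltnNge degl.
rewrite addnS ltnS => dl.
(* A part with [s] letters, the last being [y], comes from the letter [y^(s)]. *)
pose sh (p : seq X * X) := (p.2, (size p.1).+1).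
pose ord (p q : seq X * X) := letter_le (sh q) (sh p).
have pl : perm_eq l (sort ord l) by rewrite perm_sym perm_sort.
have -> : rmulp m i (i c) l = rmulp m i (i c) (sort ord l).
  by have := rmulp_perm novm i (i c) id pl; rewrite !map_id.
have dE : degp (sort ord l) = degp l by apply/esym/perm_sumn/perm_map.
have sE : size (sort ord l) = size l by rewrite size_sort.
have : sorted ord (sort ord l) by apply: sort_sorted => p q; apply: letter_le_total.
move: (sort ord l) dE sE => {pl} l2 dE sE srt.
pose ys := map sh l2; pose h := flatten (map fst l2).
have pos : all (fun p => 0 < p.2)%N ys by rewrite all_map; apply/allP.
have l2E : l2 = blocks h ys.
  rewrite /h /ys; elim: (l2) => //= -[cs y] l3 IHl /=.
  by rewrite take_size_cat // drop_size_cat // -IHl.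
have sz : size h = (\sum_(p <- ys) p.2.-1)%N.
  rewrite /h /ys; elim: (l2) => [|p l3 IHl] /=; first by rewrite big_nil.
  by rewrite size_cat big_cons IHl.
(* [gs] is the increasing list of the undifferentiated letters of the normal form; its reverse
   [g0 :: g] is the order in which φ consumes them. *)
pose gs := sort (fun c c' : X => c <= c')%O (c :: h).
have pg : perm_eq gs (c :: h) by rewrite perm_sort.
have sg : sorted (fun c c' : X => c <= c')%O gs by apply/sort_sorted/le_total.
case E : (rev gs) => [|g0 g].
  by have := perm_size pg; rewrite -size_rev E.
have gsE : gs = rev (g0 :: g) by rewrite -E revK.
have pgh : perm_eq (c :: h) (g0 :: g).
  by rewrite perm_sym -(perm_rev (g0 :: g)) -gsE.
have szg : size g = (\sum_(p <- ys) p.2.-1)%N.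
  by have /perm_size[<-] := pgh.
pose a := DiffWord (head c gs) (behead gs) ys.
have aE : dw_head a :: dw_tail a = rev (g0 :: g).
  by rewrite -gsE /=; case: (gs) gsE => //; rewrite rev_cons; case: (rev g).
have na : normal_forms X a.
  have posa : all (fun b : letter => 1 <= b.2)%N (dw_pos a) by [].
  split=> //; first by rewrite aE -gsE.
    by rewrite /= sorted_map.
  apply/eqP; rewrite (wtN1E posa) aE size_rev /= szg add1n; apply/eqP; congr _.+1.
  by apply: eq_bigr => p _; rewrite subn1.
rewrite -(subrK (ev (phi a)) (rmulp _ _ _ _)); apply: lspanD; last first.
  by apply: lspan_gen; exists a.
rewrite (word_eval_phi (a := a) pos szg aE) l2E.
apply: lspan_sub (pspan_blocks_perm novm i pos sz pgh) => _ [c' [l' [sl' dl' ->]]].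
apply: IHk; rewrite dl' -(degp_blocks pos sz) -l2E dE.
by rewrite (leq_ltn_trans dl) // ltn_add2r -sE -(size_map sh).
Qed.

Lemma lspan_word_eval w : lspan phi_vals (ev w).
Proof.
suff [n] : exists n, pspan m i 0 n (ev w).
  by apply: lspan_sub => _ [c [l [_ _ ->]]]; apply: lspan_rmulp.
elim: w => [x|u [n IHu] v [n' IHv]] /=.
  by exists 0%N; apply: (@pspan_gen _ _ _ _ _ 0 0 x [::]).
by exists (n + n').+1; apply: (@pspan_mul _ _ _ novm _ _ 0 _ 0).
Qed.

End PhiEval.

(** * Commutative algebras with a derivation, and monoid algebras *)

Lemma derivation_novikov (F : fieldType) (A : comAlgType F) (d : A -> A) :
    linear d -> (forall u v, d (u * v) = d u * v + u * d v) ->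
  novikov (fun u v => u * d v).
Proof.
move=> dL dM; split.
- by move=> v a u w; rewrite mulrDl scalerAl.
- by move=> u a v w; rewrite dL mulrDr scalerAr.
- by move=> x1 x2 x3; rewrite !dM; ring.
- by move=> x1 x2 x3; ring.
Qed.

Local Notation "1" := mone : monom_scope.
Local Notation "k * l" := (mmul k l) : monom_scope.

(* Abstract because unifying through the finitely supported
   functions of {malg F[M]} does not terminate in practice. *)
Record monoid_algebra (F : fieldType) (M : conomType) := {
  ma_sort :> comAlgType F;
  ma_mon : M -> ma_sort;
  ma_mon1 : ma_mon 1%M = 1;
  ma_monM : forall k l, ma_mon k * ma_mon l = ma_mon (k * l)%M;
  ma_span : forall u, lspan (fun v => exists k, v = ma_mon k) u;
  ma_coef : M -> {scalar ma_sort};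
  ma_coefU : forall k l, ma_coef k (ma_mon l) = (l == k)%:R;
  ma_ext : (M -> ma_sort) -> {linear ma_sort -> ma_sort};
  ma_extU : forall h k, ma_ext h (ma_mon k) = h k
}.

Section MonoidAlgebra.

Variables (F : fieldType) (M : conomType).

Fact mcoeff_scalar (k : M) : scalar (mcoeff k : {malg F[M]} -> F).
Proof. by move=> c u v; rewrite mcoeffD mcoeffZ. Qed.

Fact malg_span (u : {malg F[M]}) : lspan (fun v => exists k, v = << k >>) u.
Proof.
rewrite -(lin_ext_id u) lin_extE; apply: lspan_sum => k.
by apply/lspanZ/lspan_gen; exists k.
Qed.

Fact malgUM (k l : M) : << k >> * << l >> = << (k * l)%M >> :> {malg F[M]}.
Proof. by rewrite malgM_def fgmulUU mulr1. Qed.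

Definition malg_monoid_algebra : monoid_algebra F M :=
  {| ma_sort := {malg F[M]} : comAlgType F;
     ma_mon1 := mpolyC1E M F;
     ma_monM := malgUM;
     ma_span := malg_span;
     ma_coef := fun k =>
       HB.pack (mcoeff k) (GRing.isLinear.Build _ _ _ _ (mcoeff k) (mcoeff_scalar k));
     ma_coefU := fun k l => @mcoeffU1 M F l k;
     ma_ext := fun h => lin_ext h;
     ma_extU := @lin_extU F M _ |}.

End MonoidAlgebra.

(** * Differential polynomials, filtered by the number of differentiated letters *)

Section DifferentialPolynomials.

Variables (F : fieldType) (X : choiceType).

Local Notation letter := (X * nat)%type.
Local Notation mon := {cmonom letter}.

Variable P : monoid_algebra F mon.

Local Notation "<< k >>" := (ma_mon P k) : ring_scope.

(** One term of the Leibniz rule. The division is truncated if [a] does not occur in [k], but then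
    the coefficient [k a] in [mon_der] is zero. *)
Definition mon_step (a : letter) (k : mon) : mon :=
  (divcm k (ucm a) * ucm (a.1, a.2.+1))%M.

Definition mon_der (k : mon) : P :=
  \sum_(a <- finsupp k) (k a)%:R *: << mon_step a k >>.

Definition der : {linear P -> P} := ma_ext mon_der.

Lemma mon_derEw (d : {fset letter}) (k : mon) : (finsupp k `<=` d)%fset ->
  mon_der k = \sum_(a <- d) (k a)%:R *: << mon_step a k >>.
Proof.
move=> kd; rewrite /mon_der (big_fset_incl _ kd) // => a _.
by rewrite -cmE_eq0 => /eqP ->; rewrite scale0r.
Qed.

Lemma mon_stepM a (k l : mon) : k a != 0%N ->
  mon_step a (k * l)%M = (mon_step a k * l)%M.
Proof.
move=> ka; apply/eqP/cmP => b; rewrite !cmM !divcmE !cmM !cmU.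
by have [<-|_] := eqVneq a b; lia.
Qed.

Lemma mon_derM (k l : mon) :
  mon_der (k * l)%M = mon_der k * << l >> + << k >> * mon_der l.
Proof.
pose d := (finsupp k `|` finsupp l)%fset.
rewrite (@mon_derEw d (k * l)%M) ?mdomD ?fsubset_refl //.
rewrite (@mon_derEw d k) ?fsubsetUl // (@mon_derEw d l) ?fsubsetUr //.
rewrite mulr_suml mulr_sumr -big_split /=; apply: eq_bigr => a _.
have step (p q : mon) :
    (p a)%:R *: (<< mon_step a p >> * << q >>) = (p a)%:R *: << mon_step a (p * q)%M >>.
  rewrite ma_monM; have [->|pa] := eqVneq (p a) 0%N; first by rewrite !scale0r.
  by rewrite (mon_stepM q pa).
rewrite -scalerAl -scalerAr step [X in _ + _ *: X]mulrC step (mulmC l k).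
by rewrite -scalerDl -natrD (cmM a k l).
Qed.

Lemma derU k : der << k >> = mon_der k.
Proof. exact: ma_extU. Qed.

Lemma derM u v : der (u * v) = der u * v + u * der v.
Proof.
elim: (ma_span u) => {u} [_ [k ->]||u1 u2 _ E1 _ E2|c u _ E].
- elim: (ma_span v) => {v} [_ [l ->]||v1 v2 _ E1 _ E2|c v _ E].
  + by rewrite ma_monM !derU mon_derM.
  + by rewrite !(mulr0, linear0, addr0).
  + by rewrite mulrDr !linearD E1 E2 !mulrDr addrACA.
  + by rewrite -scalerAr !linearZZ E scalerDr !scalerAr.
- by rewrite !(mul0r, linear0, addr0).
- by rewrite mulrDl !linearD E1 E2 !mulrDl addrACA.
- by rewrite -scalerAl !linearZZ E scalerDr !scalerAl.
Qed.

Definition der_mul (u v : P) : P := u * der v.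

Lemma der_novikov : novikov der_mul.
Proof. exact: derivation_novikov (linearP der) derM. Qed.

Definition gen (a : letter) : P := << ucm a >>.

Lemma der_gen x r : der (gen (x, r)) = gen (x, r.+1).
Proof.
rewrite derU /mon_der mdomU big_seq_fset1 cmUU scale1r; congr << _ >>.
by apply/eqP/cmP => b; rewrite cmM divcmE subnn.
Qed.

Definition dcount (k : mon) : nat :=
  (\sum_(a <- finsupp k) (if (0 < a.2)%N then k a else 0))%N.

Lemma dcountEw (d : {fset letter}) (k : mon) : (finsupp k `<=` d)%fset ->
  dcount k = (\sum_(a <- d) (if (0 < a.2)%N then k a else 0))%N.
Proof.
move=> kd; rewrite /dcount (big_fset_incl _ kd) // => a _.
by rewrite -cmE_eq0 => /eqP ->; case: ifP.
Qed.

Lemma dcountM (k l : mon) : dcount (k * l)%M = (dcount k + dcount l)%N.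
Proof.
pose d := (finsupp k `|` finsupp l)%fset.
rewrite (@dcountEw d (k * l)%M) ?mdomD ?fsubset_refl //.
rewrite (@dcountEw d k) ?fsubsetUl // (@dcountEw d l) ?fsubsetUr //.
rewrite -big_split /=; apply: eq_bigr => a _.
by rewrite cmM; case: ifP.
Qed.

Lemma dcountU (a : letter) : dcount (ucm a) = (0 < a.2)%N.
Proof. by rewrite /dcount mdomU big_seq_fset1 cmUU; case: ifP. Qed.

Lemma dcount1 : dcount 1%M = 0%N.
Proof. by rewrite /dcount mdom1 big_seq_fset0. Qed.

(** The letter put in is always differentiated, whether or not the one taken out was. *)
Lemma dcount_step a (k : mon) : k a != 0%N ->
  (0 < dcount (mon_step a k))%N /\ (dcount k <= dcount (mon_step a k))%N.
Proof.
move=> ka; have -> : dcount k = (dcount (divcm k (ucm a)) + (0 < a.2))%N.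
  rewrite -dcountU -dcountM; congr dcount.
  by apply/eqP/cmP => b; rewrite cmM divcmE cmU; have [<-|_] := eqVneq a b; lia.
by rewrite dcountM dcountU /= addn1; split=> //; case: (0 < a.2)%N; rewrite ?addn1 ?addn0.
Qed.

Definition dfilt (n : nat) : P -> Prop :=
  lspan (fun u => exists2 k : mon, (n <= dcount k)%N & u = << k >>).

Lemma dfilt_leq n n' u : (n <= n')%N -> dfilt n' u -> dfilt n u.
Proof.
move=> nn'; apply: lspan_sub => _ [k n'k ->].
by apply: lspan_gen; exists k => //; apply: leq_trans n'k.
Qed.

Lemma dfilt_coef n u k : dfilt n u -> (dcount k < n)%N -> ma_coef P k u = 0.
Proof.
move=> nu kn; elim: nu => {u} [_ [l nl ->]||u v _ Eu _ Ev|c u _ Eu].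
- rewrite ma_coefU; have [lk|//] := eqVneq l k.
  by rewrite lk leqNgt kn in nl.
- by rewrite linear0.
- by rewrite linearD Eu Ev addr0.
- by rewrite linearZ /= Eu mulr0.
Qed.

Lemma dfilt0 u : dfilt 0 u.
Proof.
apply: lspan_sub (ma_span u) => _ [k ->].
by apply: lspan_gen; exists k.
Qed.

Lemma dfilt_mul n n' u v : dfilt n u -> dfilt n' v -> dfilt (n + n') (u * v).
Proof.
move=> nu; apply: (lspan_linear (f := fun w => u * w)).
  by move=> c w w'; rewrite mulrDr scalerAr.
move=> _ [l nl ->]; move: u nu.
apply: (lspan_linear (f := fun w => w * _)).
  by move=> c w w'; rewrite mulrDl scalerAl.
move=> _ [k nk ->]; rewrite ma_monM; apply: lspan_gen.
by exists (k * l)%M => //; rewrite dcountM leq_add.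
Qed.

Lemma dfilt_der n u : dfilt n u -> dfilt (maxn 1 n) (der u).
Proof.
apply: (lspan_linear (linearP der)) => _ [k nk ->]; rewrite derU.
rewrite /mon_der big_seq; apply: big_ind.
- exact: lspan0.
- exact: lspanD.
move=> a; rewrite -cmE_neq0 => ka.
apply/lspanZ/lspan_gen; exists (mon_step a k) => //.
have [s0 sk] := dcount_step ka.
by rewrite geq_max s0 (leq_trans nk).
Qed.

Lemma dfilt1_der u : dfilt 1 (der u).
Proof. by have := dfilt_der (dfilt0 u). Qed.

Local Notation part := (seq X * X)%type.
Local Notation x0 := (fun x => gen (x, 0%N)).

(** The term of the derivative of the right-normed word [p] in which all derivations fall on the
    last letter. *)
Definition part_lead (p : part) : P :=
  (\prod_(c <- p.1) x0 c) * gen (p.2, (size p.1).+1).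

Lemma der_rnormed_lead (p : part) :
  dfilt 2 (der (rnormed der_mul x0 p) - part_lead p).
Proof.
case: p => cs y; rewrite /part_lead /=; elim: cs => [|c cs IHcs].
  by rewrite big_nil mul1r der_gen subrr; apply: lspan0.
rewrite /rnormed /= -/(rnormed der_mul x0 (cs, y)) /der_mul derM.
set w := der (rnormed _ _ _) in IHcs *; set Y := gen (y, _) in IHcs *.
rewrite big_cons /= -(der_gen y (size cs).+1) -/Y.
set Q := \prod_(d <- cs) _ in IHcs *.
(* In the outer terms, differentiating [c] or [Q] adds a differentiated letter to the one in [w] or
   [Y]; the middle term is covered by induction. *)
have -> : der (x0 c) * w + x0 c * der w - x0 c * Q * der Y =
    der (x0 c) * w + (x0 c * der (w - Q * Y) + x0 c * (der Q * Y)).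
  have -> : der (w - Q * Y) = der w - (der Q * Y + Q * der Y).
    by rewrite -derM linearB.
  by ring.
have Y1 : dfilt 1 Y by rewrite /Y -der_gen; apply: dfilt1_der.
apply: lspanD; first exact: (dfilt_mul (dfilt1_der _) (dfilt1_der _)).
apply: lspanD; first exact: (dfilt_mul (dfilt0 _) (dfilt_der IHcs)).
exact: (dfilt_mul (dfilt0 _) (dfilt_mul (dfilt1_der _) Y1)).
Qed.

Lemma dfilt_rmulp u (l : seq part) : dfilt (size l) (rmulp der_mul x0 u l).
Proof.
elim: l => [|p l IHl]; first exact: dfilt0.
by rewrite [size _]/= -addn1; apply/(dfilt_mul IHl)/dfilt1_der.
Qed.

Lemma rmulp_lead u (l : seq part) :
  dfilt (size l).+1 (rmulp der_mul x0 u l - u * \prod_(p <- l) part_lead p).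
Proof.
elim: l => [|p l IHl].
  by rewrite big_nil mulr1 subrr; apply: lspan0.
rewrite big_cons [rmulp _ _ _ _]/= {1}/der_mul.
have := der_rnormed_lead p; have := dfilt1_der (rnormed der_mul x0 p).
have := dfilt_rmulp u l.
set A := rmulp _ _ _ _ in IHl *; set B := der _; set B0 := part_lead p.
set A0 := \prod_(q <- l) _ in IHl * => Al B1 BB0.
(* The two products are compared one factor at a time: each error term lies one step deeper in the
   filtration than what it corrects. *)
have -> : A * B - u * (B0 * A0) = (A - u * A0) * B0 + A * (B - B0) by ring.
apply: lspanD; last first.
  by have := dfilt_mul Al BB0; rewrite addn2.
have B01 : dfilt 1 B0.
  by rewrite -[B0](subKr B); apply/(lspanB B1)/(dfilt_leq _ BB0).
by have := dfilt_mul IHl B01; rewrite addn1.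
Qed.

Definition mon_of (w : seq letter) : mon := \big[mmul/1%M]_(a <- w) ucm a.

Lemma prod_gen w : \prod_(a <- w) gen a = << mon_of w >>.
Proof.
rewrite /mon_of; elim: w => [|a w IHw]; first by rewrite !big_nil ma_mon1.
by rewrite !big_cons IHw ma_monM.
Qed.

Lemma mon_ofE w a : mon_of w a = count_mem a w.
Proof.
rewrite /mon_of; elim: w => [|b w IHw]; first by rewrite big_nil cm1.
by rewrite big_cons cmM cmU IHw.
Qed.

Lemma mon_of_perm w w' : mon_of w = mon_of w' -> perm_eq w w'.
Proof.
by move=> E; apply/allP => a _; rewrite /= -!mon_ofE E.
Qed.

Lemma dcount_mon_of w : dcount (mon_of w) = count (fun a => 0 < a.2)%N w.
Proof.
rewrite /mon_of; elim: w => [|b w IHw]; first by rewrite big_nil dcount1.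
by rewrite big_cons dcountM dcountU IHw.
Qed.

(** The block of [y^(s)] has [s.-1] letters, so its leading term ends in [y^(s)] again. Multiplied
    by the starting letter, the product is the original monomial. *)
Lemma prod_part_lead_blocks h (ys : seq letter) : all (fun p => 0 < p.2)%N ys ->
    size h = (\sum_(p <- ys) p.2.-1)%N ->
  \prod_(p <- blocks h ys) part_lead p = (\prod_(c <- h) x0 c) * \prod_(b <- ys) gen b.
Proof.
elim: ys => [|[y s] ys IHys] in h *.
  by rewrite big_nil => _ /size0nil ->; rewrite !big_nil mulr1.
rewrite !big_cons /= => /andP[s0 pos] sz.
rewrite IHys //; last by rewrite size_drop sz addKn.
rewrite /part_lead /= size_takel ?sz ?leq_addr // prednK //.
by rewrite -{3}[h](cat_take_drop s.-1) big_cat /=; ring.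
Qed.

End DifferentialPolynomials.

(** * Leading monomials of the values of φ *)

Section Leading.

Variables (F : fieldType) (disp : Order.disp_t) (X : orderType disp).
Variable P : monoid_algebra F {cmonom (X * nat)%type}.

Local Notation "<< k >>" := (ma_mon P k) : ring_scope.

Local Notation mon a := (mon_of (dw_letters a)).
Local Notation ev := (word_eval (@der_mul F X P) (fun x => gen P (x, 0%N))).

Lemma dcount_normal (a : diffword X) : normal_forms X a ->
  dcount (mon a) = size (dw_pos a).
Proof.
case=> _ _ pos _; rewrite dcount_mon_of count_cat count_map (@eq_count _ _ pred0) //.
by rewrite count_pred0 add0n; apply/eqP; rewrite -all_count.
Qed.

Lemma phi_lead (a : diffword X) : normal_forms X a ->
  dfilt (size (dw_pos a)).+1 (ev (phi a) - << mon a >>).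
Proof.
move=> na; case: (na) => _ _ pos _.
case E : (rev (dw_head a :: dw_tail a)) => [|c h].
  by move/(congr1 size): E; rewrite size_rev.
have aE : dw_head a :: dw_tail a = rev (c :: h) by rewrite -E revK.
have sz : size h = (\sum_(p <- dw_pos a) p.2.-1)%N.
  rewrite -(normal_size na); apply: succn_inj.
  by rewrite -[LHS]/(size (c :: h)) -size_rev -aE.
rewrite (word_eval_phi (der_novikov P) _ pos sz aE).
have -> : << mon a >> =
    gen P (c, 0%N) * \prod_(p <- blocks h (dw_pos a)) part_lead P p.
  rewrite prod_part_lead_blocks // mulrA -prod_gen /dw_letters aE.
  rewrite big_cat big_map; congr (_ * _).
  by rewrite (perm_big (c :: h)) ?perm_rev // big_cons.
by rewrite -(size_blocks h (dw_pos a)); apply: rmulp_lead.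
Qed.

Lemma coef_phi_diag (a : diffword X) : normal_forms X a -> ma_coef P (mon a) (ev (phi a)) = 1.
Proof.
move=> na; rewrite -[ev _](subrK << mon a >>) linearD ma_coefU eqxx.
by rewrite (dfilt_coef (phi_lead na)) ?add0r // dcount_normal.
Qed.

(** With [coef_phi_diag], this makes the coefficient matrix unitriangular with respect to the number
    of differentiated letters; distinct normal forms have distinct monomials. *)
Lemma coef_phi_eq0 (a b : diffword X) : normal_forms X a -> normal_forms X b ->
    (size (dw_pos a) <= size (dw_pos b))%N -> ma_coef P (mon a) (ev (phi b)) != 0 -> a = b.
Proof.
move=> na nb ab; rewrite -[ev _](subrK << mon b >>) linearD.
rewrite (dfilt_coef (phi_lead nb)) ?dcount_normal // add0r ma_coefU.
have [E _|_] := eqVneq (mon b) (mon a); last by rewrite eqxx.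
by apply: normal_form_uniq => //; apply/mon_of_perm/esym.
Qed.

End Leading.

(** * Independence and spanning in the free Novikov algebra *)

Section Basis.

Variables (F : fieldType) (disp : Order.disp_t) (X : orderType disp).
Variable P : monoid_algebra F {cmonom (X * nat)%type}.

Local Notation lift := (nov_lift (@der_mul F X P) (fun x => gen P (x, 0%N))).
Local Notation ev := (word_eval (@der_mul F X P) (fun x => gen P (x, 0%N))).

Lemma lift_eval (w : word X) : lift (nov_eval F w) = ev w.
Proof. by rewrite nov_evalE (nov_lift_pi _ (der_novikov P)) lin_extU. Qed.

Lemma nov_eval_phi_inj (a b : diffword X) : normal_forms X a -> normal_forms X b ->
  nov_eval F (phi a) = nov_eval F (phi b) -> a = b.
Proof.
move=> na nb; move/(congr1 lift); rewrite !lift_eval.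
wlog ab : a b na nb / (size (dw_pos a) <= size (dw_pos b))%N.
  by move=> H E; case/orP: (leq_total (size (dw_pos a)) (size (dw_pos b)))
    => ab; [|apply/esym]; apply: H.
move=> E; apply: (coef_phi_eq0 (P := P)) => //.
by rewrite -E coef_phi_diag // oner_neq0.
Qed.

Lemma nov_eval_phi_indep :
  lin_indep [set nov_eval F w | w in [set phi a | a in normal_forms X]].
Proof.
move=> s k us sS sum0 v vs.
have [_ [a na <-] E] := sS _ vs; rewrite -{v}E in vs *.
(* At the monomial of [a], normal forms with fewer differentiated letters have coefficient zero in
   the relation by induction, and those with as many or more contribute nothing unless equal to
   [a]. *)
have [n] := ubnP (size (dw_pos a)); elim: n => // n IHn in a na vs *.
rewrite ltnS => an.
pose f u := ma_coef P (mon_of (dw_letters a)) (lift u).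
have fL : scalar f.
  move=> c u v; rewrite /f (nov_lift_linear (fun x => gen P (x, 0%N)) (der_novikov P)).
  by rewrite linearP.
have [f' f'E] : exists f' : {scalar Nov F X}, f' =1 f.
  pose g : {scalar Nov F X} := HB.pack f (GRing.isLinear.Build _ _ _ _ f fL).
  by exists g.
have fphi b : f' (nov_eval F (phi b)) = ma_coef P (mon_of (dw_letters a)) (ev (phi b)).
  by rewrite f'E -lift_eval.
have := congr1 f' sum0.
rewrite linear_sum linear0 (bigD1_seq (nov_eval F (phi a))) //= linearZ /=.
rewrite fphi coef_phi_diag // mulr1.
rewrite big_seq_cond big1 ?addr0 // => u /andP[us' ua].
rewrite linearZ /=; have [_ [b nb <-] E] := sS _ us'; rewrite -{u}E in us' ua *.
have [ba|ab] := ltnP (size (dw_pos b)) (size (dw_pos a)).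
  by rewrite IHn ?mul0r // (leq_trans ba).
rewrite fphi; apply/eqP; rewrite mulf_eq0; apply/orP; right.
by apply: contraNT ua => /(coef_phi_eq0 na nb ab) ->.
Qed.

Lemma nov_eval_phi_spanning :
  spanning [set nov_eval F w | w in [set phi a | a in normal_forms X]].
Proof.
move=> u; apply: lspan_lin_comb; rewrite -[u]nov_reprK -(lin_ext_id (nov_repr u)).
rewrite (lin_ext_comp _ _ (linearP (nov_pi F X))) lin_extE.
apply: lspan_sum => w; apply: lspanZ; rewrite /= -nov_evalE.
apply: lspan_sub (lspan_word_eval (Nov_novikov F X) _ w) => _ [a na ->].
by apply: lspan_gen; exists (phi a) => //; exists a.
Qed.

End Basis.

Theorem theorem2 (F : fieldType) (charF0 : [pchar F] =i pred0)
    (disp : Order.disp_t) (X : orderType disp)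
    (wfX : well_founded (fun x y : X => (x < y)%O)) :
  let N_phi := [set phi a | a in normal_forms X] in
  linear_basis [set nov_eval F w | w in N_phi] /\
  (forall a b : diffword X, normal_forms X a -> normal_forms X b ->
     nov_eval F (phi a) = nov_eval F (phi b) -> a = b).
Proof.
(* The differential polynomials are the model in which the values of φ are separated. *)
have P : monoid_algebra F {cmonom (X * nat)%type} := malg_monoid_algebra _ _.
split; first by split; [exact: nov_eval_phi_indep|exact: nov_eval_phi_spanning].
by move=> a b na nb; apply: nov_eval_phi_inj.
Qed.
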